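(* Let $\delta\in\mathbb{C}$ and let $L$ be a $2$-dimensional $\delta$-Leibniz algebra over $\mathbb{C}$ with nonzero multiplication. Then $L$ is isomorphic to one of the following algebras with basis $e_1,e_2$ (products of basis elements not listed are zero); moreover, each listed algebra is a $\gamma$-Leibniz algebra for the indicated value of $\gamma$: - $\mathbf{A}_3$ ($\gamma$ arbitrary): $e_1e_1=e_2$; - $\mathbf{B}_2(1)$ ($\gamma=0$): $e_2e_1=e_1$; - $\mathbf{B}_2(0)$ ($\gamma=1$): $e_1e_2=e_1$; - $\mathbf{B}_3$ ($\gamma=1$): $e_1e_2=e_2,\ e_2e_1=-e_2$; - $\mathbf{D}_2(0,0)$ ($\gamma=\tfrac12$): $e_1e_1=e_1$; - $\mathbf{D}_2(0,1)$ ($\gamma=\tfrac12$): $e_1e_1=e_1,\ e_2e_1=e_2$; - $\mathbf{D}_2(1,1)$ ($\gamma=\tfrac12$): $e_1e_1=e_1,\ e_1e_2=e_2,\ e_2e_1=e_2$; - $\mathbf{E}_1(1,0,0,1)$ ($\gamma=\tfrac12$): $e_1e_1=e_1,\ e_1e_2=e_1,\ e_2e_1=e_2,\ e_2e_2=e_2$; - $\mathbf{E}_1(0,0,0,0)$ ($\gamma=\tfrac12$): $e_1e_1=e_1,\ e_2e_2=e_2$.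
   Context: An algebra means a complex vector space with a bilinear multiplication, not assumed associative. For $\delta\in\mathbb{C}$, a $\delta$-Leibniz algebra is an algebra satisfying $(xy)z=\delta\big((xz)y+x(yz)\big)$ for all $x,y,z$. *)

(* Defs.v *)
From HB Require Import structures.
From mathcomp Require Import all_boot all_algebra.
From mathcomp Require Import ring.

Set Implicit Arguments.
Unset Strict Implicit.
Unset Printing Implicit Defensive.

Import GRing.Theory.
Local Open Scope ring_scope.

Definition leibniz_algebra (K : fieldType) (delta : K) (A : lmodType K)
    (mul : {bilinear A -> A -> A}) : Prop :=
  forall x y z : A,
    mul (mul x y) z = delta *: (mul (mul x z) y + mul x (mul y z)).

Definition alg_iso (K : fieldType) (A B : lmodType K)
    (mulA : {bilinear A -> A -> A}) (mulB : {bilinear B -> B -> B}) : Prop :=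
  exists f : {linear A -> B},
    bijective f /\ forall x y : A, f (mulA x y) = mulB (f x) (f y).

Section TwoDimAlgebras.
Variable K : fieldType.

(* The basis of 'rV[K]_2, indexed from 1 as in the multiplication tables. *)
Definition e1 : 'rV[K]_2 := delta_mx 0 ord0.
Definition e2 : 'rV[K]_2 := delta_mx 0 ord_max.

Section Table.
Variables c11 c12 c21 c22 : 'rV[K]_2.

Definition table_mul (x y : 'rV[K]_2) : 'rV[K]_2 :=
  let x1 := x 0 ord0 in let x2 := x 0 ord_max in
  let y1 := y 0 ord0 in let y2 := y 0 ord_max in
  (x1 * y1) *: c11 + (x1 * y2) *: c12 + (x2 * y1) *: c21 + (x2 * y2) *: c22.

Fact table_mul_bilinear : bilinear_for *:%R *:%R table_mul.
Proof.
by split=> [y|x] a u v; apply/rowP => i; rewrite !mxE /=; ring.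
Qed.

HB.instance Definition _ :=
  bilinear_isBilinear.Build K 'rV[K]_2 'rV[K]_2 'rV[K]_2 *:%R *:%R
    table_mul table_mul_bilinear.

Definition table_alg : {bilinear 'rV[K]_2 -> 'rV[K]_2 -> 'rV[K]_2} := table_mul.

Lemma table_algE :
  [/\ table_alg e1 e1 = c11, table_alg e1 e2 = c12,
      table_alg e2 e1 = c21 & table_alg e2 e2 = c22].
Proof.
by split; rewrite /= /table_mul !mxE /=
  !(mulr0, mul0r, mulr1, scale0r, scale1r, addr0, add0r).
Qed.

End Table.

(* Arguments of table_alg, in order: e1 e1, e1 e2, e2 e1, e2 e2. *)
Definition A3     := table_alg e2 0 0 0.
Definition B2_1   := table_alg 0 0 e1 0.
Definition B2_0   := table_alg 0 e1 0 0.
Definition B3     := table_alg 0 e2 (- e2) 0.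
Definition D2_00  := table_alg e1 0 0 0.
Definition D2_01  := table_alg e1 0 e2 0.
Definition D2_11  := table_alg e1 e2 e2 0.
Definition E1_1001 := table_alg e1 e1 e2 e2.
Definition E1_0000 := table_alg e1 0 0 e2.

End TwoDimAlgebras.

(* Main.v *)
Require Import Defs.
From mathcomp Require Import all_boot all_algebra.
From mathcomp Require Import ring.
From mathcomp Require Import reals complex.

(** Classification of the two-dimensional algebras satisfying
    (xy)z = delta ((xz)y + x(yz)), over any algebraically closed field.

    Everything starts from a line stable under squaring: a nonzero v with
    vv = l v. In a basis (e, f) where ee is not on the line of e, the condition
    that te + f has a square proportional to itself is a cubic equation in t, so
    such a v exists ([exists_invariant_line]). Rescaling it gives either an
    idempotent (l != 0) or an element of square zero (l = 0).

    Suppose e is a nonzero idempotent ([listed_idempotent]). The identity at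
    (e, e, e) forces 2 delta = 1, and then its instances involving e say that
    right multiplication by e is a projector. If it is not the identity, a
    vector f of its kernel satisfies ef = fe = 0 and ff is a multiple of f. If
    it is the identity, left multiplication by e is a projector as well; either
    it kills some f, and then ff = 0, or e is a unit, and a monic quadratic
    polynomial over an algebraically closed field tells whether the algebra is
    K[X]/(X^2) or K x K ([listed_unital]).

    Suppose ee = 0 and complete e into a basis (e, f) ([listed_square_zero]).
    For delta = 0 all products (xy)z vanish. For delta != 0, look at
    ef = c e + d f and fe = a e + b f. If d != 0 or b != 0, comparing the two
    sides of the identity forces delta = 1, and (e, ef), respectively (fe, e),
    is up to scaling a basis with a listed table. Otherwise the line of e is a
    two-sided ideal and only ff = p e + q f is left to understand: q != 0 forces
    delta = 1/2 and an idempotent exists, while q = 0 gives the remaining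
    tables.

    An isomorphism with a listed algebra is always produced by exhibiting a
    basis with the right multiplication table ([alg_iso_frame]). *)

Set Implicit Arguments.
Unset Strict Implicit.
Unset Printing Implicit Defensive.

Import GRing.Theory.
Local Open Scope ring_scope.
Local Open Scope complex_scope.

(** * Bases of a two-dimensional space *)

Section TwoDimSpace.
Variables (K : fieldType) (L : vectType K).
Implicit Types e f x y : L.

(** Equalities between linear combinations are proved coordinatewise, where they
    become identities in the base field; [vec_field] below relies on this. *)
Lemma vec_eq x y :
  (forall i, coord (vbasis {:L}) i x = coord (vbasis {:L}) i y) -> x = y.
Proof.
move=> exy; rewrite (coord_vbasis (memvf x)) (coord_vbasis (memvf y)).
by apply: eq_bigr => i _; rewrite exy.
Qed.

Lemma free2P e f :
  reflect (forall a b, a *: e + b *: f = 0 -> a = 0 /\ b = 0) (free [:: e; f]).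
Proof.
apply: (iffP idP) => [ef_free a b ab0 | ef_inj].
  have /freeP/(_ (fun i => if i == ord0 then a else b)) :
    free [tuple e; f] by [].
  rewrite !big_ord_recl big_ord0 /= addr0 => /(_ ab0) k0.
  by split; [have := k0 ord0 | have := k0 ord_max].
suff: free [tuple e; f] by [].
apply/freeP => k; rewrite !big_ord_recl big_ord0 /= addr0 => /ef_inj[k0 k1].
by case=> [[|[|//]]] lt_i; [rewrite -[RHS]k0 | rewrite -[RHS]k1];
  congr (k _); apply: val_inj.
Qed.

Lemma free2_neq0l e f : free [:: e; f] -> e != 0.
Proof. by move=> /free_not0; apply; rewrite inE eqxx. Qed.

Lemma colinear_or_free e x : e != 0 -> (exists t, x = t *: e) \/ free [:: e; x].
Proof.
move=> e0; have [/vlineP[t ->] | xNe] := boolP (x \in <[e]>%VS).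
  by left; exists t.
right; rewrite (perm_free (Y := [:: x; e])); last first.
  by rewrite (perm_catC [:: e] [:: x]).
by rewrite free_cons span_seq1 xNe seq1_free.
Qed.

End TwoDimSpace.

Ltac vec_field := apply: vec_eq => ?;
  rewrite ?(linear0, linearB, linearD, linearN, linearZ) /=; field.

Section Bases.
Variables (K : fieldType) (L : vectType K).
Implicit Types e f u v x y : L.

Lemma free2_inj e f (x y x' y' : K) :
  free [:: e; f] ->
  x *: e + y *: f = x' *: e + y' *: f -> x = x' /\ y = y'.
Proof.
move=> ef_free E; have /(free2P _ _ ef_free)[/subr0_eq-> /subr0_eq->] // :
  (x - x') *: e + (y - y') *: f = 0.
by rewrite !scalerBl addrACA E -opprD subrr.
Qed.

Lemma free2_comb_neq0 e f (x y : K) : free [:: e; f] ->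
  y != 0 -> x *: e + y *: f != 0.
Proof.
by move=> ef_free y0; apply: contra_neq y0 => /(free2P _ _ ef_free)[].
Qed.

Lemma free2_change e f u v (a b c d : K) :
    free [:: e; f] -> u = a *: e + b *: f -> v = c *: e + d *: f ->
    a * d - b * c != 0 ->
  free [:: u; v].
Proof.
move=> /free2P ef_free -> -> det0; apply/free2P => s t.
have -> : s *: (a *: e + b *: f) + t *: (c *: e + d *: f) =
          (s * a + t * c) *: e + (s * b + t * d) *: f by vec_field.
move=> /ef_free[st1 st2]; split; apply/eqP; rewrite -(mulIr_eq0 _ (mulIf det0)).
  have -> : s * (a * d - b * c) = (s * a + t * c) * d - (s * b + t * d) * c.
    by ring.
  by rewrite st1 st2 !mul0r subrr.
have -> : t * (a * d - b * c) = (s * b + t * d) * a - (s * a + t * c) * b.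
  by ring.
by rewrite st1 st2 !mul0r subrr.
Qed.

Hypothesis dimL : \dim {:L} = 2%N.

Lemma free2_coord e f x : free [:: e; f] -> exists a b, x = a *: e + b *: f.
Proof.
move=> ef_free; have: basis_of {:L} [tuple e; f].
  by rewrite basisEfree ef_free subvf dimL.
move=> /coord_basis/(_ (memvf x)) ->; rewrite !big_ord_recl big_ord0 /= addr0.
by do 2!eexists.
Qed.

Lemma free2_complete e : e != 0 -> exists f, free [:: e; f].
Proof.
move=> e0; have /subvPn[x _ xNe]: ~~ ({:L} <= <[e]>)%VS.
  by apply/negP => /dimvS; rewrite dimL dim_vline e0.
have [[t ex] | ex_free] := colinear_or_free x e0; last by exists x.
by rewrite ex memvZ ?memv_line in xNe.
Qed.

(** On a plane, a projector fixing e has rank 1 or 2: either its kernel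
    complements the line of e, or it is the identity. Both cases are read off
    f - P f, which lies in the kernel. *)
Lemma linear_projector_dichotomy (P : {linear L -> L}) e :
    e != 0 -> P e = e -> (forall x, P (P x) = P x) ->
  (exists2 f, free [:: e; f] & P f = 0) \/ (forall x, P x = x).
Proof.
move=> e0 Pe PP; have [f ef_free] := free2_complete e0.
have PfP0: P (f - P f) = 0 by rewrite linearB PP subrr.
have [[t fP] | fP_free] := colinear_or_free (f - P f) e0; last first.
  by left; exists (f - P f).
right=> x; have [a [b ->]] := free2_coord x ef_free.
move: PfP0; rewrite fP linearZ /= Pe => te0.
move/eqP: fP; rewrite te0 subr_eq0 => /eqP fP.
by rewrite linearD !linearZ /= Pe -fP.
Qed.

End Bases.

(** * Multiplication tables in a basis *)

Definition lincomb (K : fieldType) (L : lmodType K) (u v : L)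
    (r : 'rV[K]_2) : L :=
  r 0 ord0 *: u + r 0 ord_max *: v.

Section Lincomb.
Variables (K : fieldType) (L : vectType K).
Implicit Types u v : L.

Lemma lincomb_e1 u v : lincomb u v (e1 K) = u.
Proof. by rewrite /lincomb !mxE /= scale1r scale0r addr0. Qed.
Lemma lincomb_e2 u v : lincomb u v (e2 K) = v.
Proof. by rewrite /lincomb !mxE /= scale1r scale0r add0r. Qed.
Lemma lincomb0 u v : lincomb u v 0 = 0.
Proof. by rewrite /lincomb !mxE /= !scale0r addr0. Qed.
Lemma lincombN u v r : lincomb u v (- r) = - lincomb u v r.
Proof. by rewrite /lincomb !mxE /= !scaleNr opprD. Qed.
Definition lincombE := (lincomb_e1, lincomb_e2, lincomb0, lincombN).

End Lincomb.

Section Frames.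
Variables (K : fieldType) (L : vectType K) (mul : {bilinear L -> L -> L}).
Hypothesis dimL : \dim {:L} = 2%N.

(** The coordinate map in the basis (u, v) is the isomorphism; bilinearity
    reduces its multiplicativity to the four products of basis vectors. *)
Lemma alg_iso_frame (u v : L) (c11 c12 c21 c22 : 'rV[K]_2) :
    free [:: u; v] ->
    mul u u = lincomb u v c11 -> mul u v = lincomb u v c12 ->
    mul v u = lincomb u v c21 -> mul v v = lincomb u v c22 ->
  alg_iso mul (table_alg c11 c12 c21 c22).
Proof.
move=> uv_free uu uv vu vv.
have [f] := linear_of_free [:: u; v] [:: e1 K; e2 K].
move=> /(_ uv_free erefl) [fu fv].
have rowE (r : 'rV[K]_2) : r 0 ord0 *: e1 K + r 0 ord_max *: e2 K = r.
  apply/rowP=> i; rewrite !mxE /=; case: i => [[|[|//]]] lt_i /=;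
  rewrite ?(mulr1, mulr0, addr0, add0r); congr (r _ _); exact: val_inj.
have fK r : f (lincomb u v r) = r.
  by rewrite /lincomb linearD !linearZ /= fu fv rowE.
have coordsP x : exists r, x = lincomb u v r.
  have [a [b ->]] := free2_coord dimL x uv_free.
  exists (a *: e1 K + b *: e2 K); rewrite /lincomb !mxE /=.
  by rewrite !(mulr1, mulr0, addr0, add0r).
exists f; split.
  exists (lincomb u v) => // x; have [r ->] := coordsP x.
  by rewrite fK.
move=> x y; have [r ->] := coordsP x; have [s ->] := coordsP y.
rewrite !fK {1 2}/lincomb.
rewrite !(linearDl mul, linearDr mul, linearZl_LR mul, linearZr_LR mul) /=.
rewrite uu uv vu vv !(fK, linearD, linearZ) /= /table_mul.
by apply/rowP => i; rewrite !mxE; ring.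
Qed.

End Frames.

Definition listed (K : fieldType) (L : lmodType K)
    (mul : {bilinear L -> L -> L}) : Prop :=
  alg_iso mul (A3 K) \/ alg_iso mul (B2_1 K) \/ alg_iso mul (B2_0 K) \/
  alg_iso mul (B3 K) \/ alg_iso mul (D2_00 K) \/ alg_iso mul (D2_01 K) \/
  alg_iso mul (D2_11 K) \/ alg_iso mul (E1_1001 K) \/ alg_iso mul (E1_0000 K).

(** * Squaring and idempotents *)

Section Classification.
Variables (K : closedFieldType) (L : vectType K) (mul : {bilinear L -> L -> L}).
Hypothesis dimL : \dim {:L} = 2%N.
Implicit Types e f x y z : L.

Let mulE := (linear0l mul, linear0r mul, linearDl mul, linearDr mul,
  linearNl mul, linearNr mul, linearBl mul, linearBr mul,
  linearZl_LR mul, linearZr_LR mul).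

(** A point of the projective line fixed by squaring; restricted to the affine
    chart te + f it is a root of a polynomial whose cubic coefficient is the
    f-coordinate of ee. *)
Lemma exists_invariant_line : exists v lambda, v != 0 /\ mul v v = lambda *: v.
Proof.
have e0 : vpick {:L} != 0 by rewrite vpick0 -dimv_eq0 dimL.
set e := vpick {:L} in e0.
have [f ef_free] := free2_complete dimL e0.
have [a1 [a2 ee]] := free2_coord dimL (mul e e) ef_free.
have [b1 [b2 ef]] := free2_coord dimL (mul e f) ef_free.
have [c1 [c2 fe]] := free2_coord dimL (mul f e) ef_free.
have [d1 [d2 ff]] := free2_coord dimL (mul f f) ef_free.
have [a20 | a20] := eqVneq a2 0.
  by exists e, a1; split; rewrite // ee a20 scale0r addr0.
(* The cubic says that the e-coordinate of (te + f)(te + f) is t times its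
   f-coordinate. *)
pose s := nth 0 [:: d1 / a2; (b1 + c1 - d2) / a2; (a1 - b2 - c2) / a2].
have [t tE] := @solve_monicpoly K 3 s isT.
exists (t *: e + f), (t ^+ 2 * a2 + t * (b2 + c2) + d2); split.
  by rewrite -[f]scale1r (free2_comb_neq0 _ ef_free) ?oner_eq0.
rewrite !mulE ee ef fe ff.
transitivity ((t ^+ 2 * a1 + t * (b1 + c1) + d1) *: e +
              (t ^+ 2 * a2 + t * (b2 + c2) + d2) *: f).
  by vec_field.
suff -> : t ^+ 2 * a1 + t * (b1 + c1) + d1 =
          (t ^+ 2 * a2 + t * (b2 + c2) + d2) * t by vec_field.
transitivity (t ^+ 3 * a2 + t ^+ 2 * (b2 + c2) + t * d2); last by ring.
by rewrite tE !big_ord_recl big_ord0 /s /=; field.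
Qed.

Lemma quadratic_root (p q : K) : exists r, r ^+ 2 = q * r + p.
Proof.
have [r rE] := @solve_monicpoly K 2 (nth 0 [:: p; q]) isT.
by exists r; rewrite rE !big_ord_recl big_ord0 /= expr0 expr1; ring.
Qed.

(** A unital algebra of dimension 2 is K[X]/(X^2 - qX - p) by the choice of a
    second basis vector f. A root r of the polynomial gives g = f - r e with
    gg = s g, where s is the other root minus r: s = 0 is the double root case,
    and otherwise g / s and e - g / s are orthogonal idempotents. *)
Lemma listed_unital e : e != 0 -> (forall x, mul e x = x) ->
  (forall x, mul x e = x) -> listed mul.
Proof.
move=> e0 ex xe; have [f ef_free] := free2_complete dimL e0.
have [p [q ff]] := free2_coord dimL (mul f f) ef_free.
have [r rE] := quadratic_root p q.
pose g := f - r *: e; pose s := q - 2 * r.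
have gg : mul g g = s *: g.
  rewrite /g !mulE !ex xe ff.
  have -> : p = r ^+ 2 - q * r by rewrite rE; ring.
  by rewrite /s; vec_field.
have eg_free : free [:: e; g].
  apply: (free2_change (a := 1) (b := 0) (c := - r) (d := 1) ef_free).
  - by vec_field.
  - by rewrite /g; vec_field.
  - by rewrite mulr1 mul0r subr0 oner_eq0.
have [s0 | s0] := eqVneq s 0.
  do 6!right; left.
  by apply: (alg_iso_frame dimL eg_free);
    rewrite lincombE ?ex ?xe ?gg ?s0 ?scale0r.
pose u := s^-1 *: g.
have uu : mul u u = u.
  by rewrite /u (linearZl_LR mul) (linearZr_LR mul) gg scalerK.
have uv_free : free [:: u; e - u].
  apply: (free2_change (a := 0) (b := s^-1) (c := 1) (d := - s^-1) eg_free).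
  - by rewrite /u; vec_field.
  - by rewrite /u; vec_field.
  - by rewrite mul0r mulr1 sub0r oppr_eq0 invr_eq0.
clearbody u; do 8!right.
by apply: (alg_iso_frame dimL uv_free);
  rewrite lincombE ?mulE ?ex ?xe ?uu ?subrr ?subr0 ?addr0 ?oppr0.
Qed.

Variable delta : K.
Hypothesis leib : leibniz_algebra delta mul.

(** At (e, e, e) the identity reads e = 2 delta e, whence delta = 1/2. *)
Lemma idempotent_leibniz e x y z : e != 0 -> mul e e = e ->
  2 *: mul (mul x y) z = mul (mul x z) y + mul x (mul y z).
Proof.
move=> e0 ee.
have d2 : delta * 2 = 1.
  have := leib e e e; rewrite !ee -mulr2n -scaler_nat scalerA.
  move/eqP; rewrite -subr_eq0 -{1}[e]scale1r -scalerBl scaler_eq0.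
  by rewrite (negPf e0) orbF subr_eq0 => /eqP <-.
by rewrite leib scalerA mulrC d2 scale1r.
Qed.

(** Instances of the identity with two arguments equal to e show that right
    multiplication by e is a projector, and that left multiplication is one too
    once right multiplication is the identity. *)
Lemma listed_idempotent e : e != 0 -> mul e e = e -> listed mul.
Proof.
move=> e0 ee; have hL x y z := @idempotent_leibniz e x y z e0 ee.
have eqZ2 x y : 2 *: x = x + y -> x = y.
  by rewrite scaler_nat mulr2n => /addrI.
have ReK x : mul (mul x e) e = mul x e.
  by apply: eqZ2; rewrite hL ee.
have := @linear_projector_dichotomy _ _ dimL (applyr mul e) e e0 ee ReK.
case=> [[f ef_free fe] | xe].
  have {}fe : mul f e = 0 := fe.
  have ef : mul e f = 0.
    have ef2 : 2 *: mul (mul e f) e = mul e f.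
      by rewrite hL ee fe linear0r addr0.
    (* ef2 reads 2 R_e(ef) = ef for the projector R_e, whose eigenvalues are
       0 and 1; applying R_e once more gives R_e(ef) = 0. *)
    have efe : mul (mul e f) e = 0.
      apply: (@eqZ2 _ 0).
      by rewrite addr0 -[in LHS]ReK -(linearZl_LR mul) ef2.
    by rewrite -ef2 efe scaler0.
  have [p [q ff]] := free2_coord dimL (mul f f) ef_free.
  have p0 : p = 0.
    have ffe : mul (mul f f) e = 0.
      by rewrite leib fe linear0l linear0r addr0 scaler0.
    move/eqP: ffe; rewrite ff !mulE ee fe scaler0 addr0 scaler_eq0.
    by rewrite (negPf e0) orbF => /eqP.
  have {}ff : mul f f = q *: f by rewrite ff p0 scale0r add0r.
  have [q0 | q0] := eqVneq q 0.
    do 4!right; left; apply: (alg_iso_frame dimL ef_free);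
      by rewrite lincombE ?ee ?ef ?fe ?ff ?q0 ?scale0r.
  do 8!right.
  have uv_free : free [:: e; q^-1 *: f].
    apply: (free2_change (a := 1) (b := 0) (c := 0) (d := q^-1) ef_free).
    - by vec_field.
    - by vec_field.
    - by rewrite mul0r mul1r subr0 invr_eq0.
  apply: (alg_iso_frame dimL uv_free);
    by rewrite lincombE ?mulE ?ee ?ef ?fe ?ff ?scalerK ?scaler0.
have {}xe x : mul x e = x := xe x.
have LeK x : mul e (mul e x) = mul e x.
  by apply/esym/eqZ2; rewrite -{1}ee hL xe.
have [[f ef_free ef] | ex] := linear_projector_dichotomy dimL e0 ee LeK;
  last first.
  exact: (listed_unital e0).
have ff : mul f f = 0.
  apply: (@eqZ2 (mul f f) 0); rewrite addr0.
  by rewrite -{1}(xe f) hL xe ef linear0r addr0.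
do 5!right; left.
by apply: (alg_iso_frame dimL ef_free); rewrite lincombE ?ee ?xe.
Qed.

(** * Algebras with an element of square zero *)

Hypothesis mul_neq0 : exists x y, mul x y != 0.

Section SquareZero.
Variables e f : L.
Hypothesis ef_free : free [:: e; f].
Hypothesis ee : mul e e = 0.

Lemma line_inj (x y : K) : x *: e = y *: e -> x = y.
Proof.
move=> xy; have [] // := free2_inj (x := x) (y := 0) (x' := y) (y' := 0) ef_free.
by rewrite xy.
Qed.

Lemma listed_A3 p : mul e f = 0 -> mul f e = 0 -> mul f f = p *: e ->
  listed mul.
Proof.
move=> ef fe ff; have p0 : p != 0.
  have [x [y]] := mul_neq0; apply: contra_neq => p0.
  have [a [b ->]] := free2_coord dimL x ef_free.
  have [c [d ->]] := free2_coord dimL y ef_free.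
  by rewrite !mulE ee ef fe ff p0 !(scale0r, scaler0, addr0).
have uv_free : free [:: f; p *: e].
  apply: (free2_change (a := 0) (b := 1) (c := p) (d := 0) ef_free).
  - by vec_field.
  - by vec_field.
  - by rewrite mul0r mul1r sub0r oppr_eq0.
by left; apply: (alg_iso_frame dimL uv_free);
  rewrite lincombE ?mulE ?ee ?ef ?fe ?ff ?scaler0.
Qed.

Lemma listed_B2_1 a p : a != 0 -> mul e f = 0 -> mul f e = a *: e ->
  mul f f = p *: e -> listed mul.
Proof.
move=> a0 ef fe ff.
have uv_free : free [:: e; a^-1 *: (f - (p / a) *: e)].
  apply: (free2_change (a := 1) (b := 0) (c := - p / a ^+ 2) (d := a^-1) ef_free).
  - by vec_field.
  - by vec_field.
  - by rewrite mul0r mul1r subr0 invr_eq0.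
right; left; apply: (alg_iso_frame dimL uv_free);
  rewrite lincombE ?mulE ?ee ?ef ?fe ?ff //; vec_field => //.
Qed.

Lemma listed_B2_0 c p : c != 0 -> mul e f = c *: e -> mul f e = 0 ->
  mul f f = p *: e -> listed mul.
Proof.
move=> c0 ef fe ff.
have uv_free : free [:: e; c^-1 *: (f - (p / c) *: e)].
  apply: (free2_change (a := 1) (b := 0) (c := - p / c ^+ 2) (d := c^-1) ef_free).
  - by vec_field.
  - by vec_field.
  - by rewrite mul0r mul1r subr0 invr_eq0.
do 2!right; left; apply: (alg_iso_frame dimL uv_free);
  rewrite lincombE ?mulE ?ee ?ef ?fe ?ff //; vec_field => //.
Qed.

Lemma listed_B3 a : a != 0 -> mul e f = - (a *: e) -> mul f e = a *: e ->
  mul f f = 0 -> listed mul.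
Proof.
move=> a0 ef fe ff.
have uv_free : free [:: a^-1 *: f; e].
  apply: (free2_change (a := 0) (b := a^-1) (c := 1) (d := 0) ef_free).
  - by vec_field.
  - by vec_field.
  - by rewrite mul0r mulr1 sub0r oppr_eq0 invr_eq0.
by do 3!right; left; apply: (alg_iso_frame dimL uv_free);
  rewrite !lincombE ?mulE ?ee ?ef ?fe ?ff ?scaler0 ?scalerN ?scalerK.
Qed.

(** All triple products (xy)z vanish. If fe != 0 it spans an ideal on which only
    multiplication on the left acts. If fe = 0 and ef is not on the line of e,
    the roles are taken over by ef and e. Otherwise the only product left is
    ff. *)
Lemma listed_delta0 : delta = 0 -> listed mul.
Proof.
move=> delta0; have mul3 x y z : mul (mul x y) z = 0.
  by rewrite leib delta0 scale0r.
have [a [b fe]] := free2_coord dimL (mul f e) ef_free.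
have [c [d ef]] := free2_coord dimL (mul e f) ef_free.
have [p [q ff]] := free2_coord dimL (mul f f) ef_free.
have b0 : b = 0.
  have := mul3 f e e; rewrite {1}fe !mulE ee scaler0 add0r => /eqP.
  have [// | b0] := eqVneq b 0.
  by rewrite scaler_eq0 fe (negPf b0) (negPf (free2_comb_neq0 _ ef_free b0)).
move: fe; rewrite b0 scale0r addr0 => fe.
have e0 : e != 0 := free2_neq0l ef_free.
have [a0 | a0] := eqVneq a 0; last first.
  have d0 : d = 0.
    have := mul3 e f e; rewrite ef !mulE ee fe scaler0 add0r scalerA => /eqP.
    by rewrite scaler_eq0 mulf_eq0 (negPf a0) (negPf e0) !orbF => /eqP.
  have q0 : q = 0.
    have := mul3 f f e; rewrite ff !mulE ee fe scaler0 add0r scalerA => /eqP.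
    by rewrite scaler_eq0 mulf_eq0 (negPf a0) (negPf e0) !orbF => /eqP.
  have ef0 : mul e f = 0.
    have := mul3 f e f; rewrite fe !mulE => /eqP.
    by rewrite scaler_eq0 (negPf a0) => /eqP.
  by apply: (@listed_B2_1 a p); rewrite // ff q0 scale0r addr0.
move: fe; rewrite a0 scale0r => fe.
have [d0 | d0] := eqVneq d 0.
  move: ef; rewrite d0 scale0r addr0 => ef.
  have c0 : c = 0.
    have := mul3 e f f; rewrite ef !mulE ef scalerA => /eqP.
    by rewrite scaler_eq0 mulf_eq0 orbb (negPf e0) orbF => /eqP.
  move: ef; rewrite c0 scale0r => ef.
  have q0 : q = 0.
    have := mul3 f f f; rewrite {1}ff !mulE ef scaler0 add0r => /eqP.
    have [// | q0] := eqVneq q 0.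
    by rewrite scaler_eq0 ff (negPf q0) (negPf (free2_comb_neq0 _ ef_free q0)).
  by apply: (@listed_A3 p); rewrite // ff q0 scale0r addr0.
have uv_free : free [:: mul e f; d^-1 *: e].
  apply: (free2_change (a := c) (b := d) (c := d^-1) (d := 0) ef_free) => //.
  - by vec_field.
  - by rewrite mulr0 mulfV // sub0r oppr_eq0 oner_eq0.
right; left; apply: (alg_iso_frame dimL uv_free);
  rewrite lincombE ?mul3 // !mulE; last by rewrite ee !scaler0.
by rewrite {1}ef !mulE ee scaler0 add0r scalerK.
Qed.

(** The identity at (f, f, e) gives a (a + c) = 0. For a != 0 the algebra is
    anticommutative up to ff, and (f, e, f) and (f, f, f) then give delta = 1
    and p = 0. *)
Lemma listed_ideal_nilpotent a c p : delta != 0 ->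
    mul f e = a *: e -> mul e f = c *: e -> mul f f = p *: e ->
  listed mul.
Proof.
move=> delta0 fe ef ff.
have [a0 | a0] := eqVneq a 0.
  move: fe; rewrite a0 scale0r => fe.
  have [c0 | c0] := eqVneq c 0; last exact: (@listed_B2_0 c p).
  by apply: (@listed_A3 p); rewrite // ef c0 scale0r.
have ca : c = - a.
  have : 0 = delta * (a * (c + a)).
    apply: line_inj; rewrite scale0r.
    have := leib f f e; rewrite ff !(fe, mulE) ee ef scaler0 => ->.
    by vec_field.
  move/esym/eqP; rewrite !mulf_eq0 (negPf delta0) (negPf a0) addr_eq0 /=.
  by move/eqP.
have ef' : mul e f = - (a *: e) by rewrite ef ca scaleNr.
have delta1 : delta = 1.
  apply: (mulIf a0); apply: (mulIf a0); apply: line_inj.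
  have := leib f e f; rewrite ff !(fe, ef', mulE) ee scaler0 sub0r !scalerN.
  by move=> /oppr_inj aae; rewrite -!scalerA -aae scale1r.
have p0 : p = 0.
  apply: (mulIf a0); apply: line_inj.
  have := leib f f f; rewrite delta1 scale1r ff !(fe, ef', mulE).
  rewrite -[X in X = _ -> _]addr0 => /addrI/esym pae.
  by rewrite -scalerA pae mul0r scale0r.
by apply: (@listed_B3 a); rewrite // ff p0 scale0r.
Qed.

(** Modulo the ideal spanned by e, the identity at (f, f, f) reads
    q^2 = 2 delta q^2, so delta = 1/2, and the square of te + f is
    (p + t (a + c)) e + q f. This is q (te + f) for a suitable t unless p != 0
    and a + c = q; but p != 0 forces a = c, and c is 0 or q, so that a + c is 0
    or 2q. Hence te + f is, up to scaling, an idempotent. *)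
Lemma listed_ideal a c p q : delta != 0 -> q != 0 ->
    mul f e = a *: e -> mul e f = c *: e -> mul f f = p *: e + q *: f ->
  listed mul.
Proof.
move=> delta0 q0 fe ef ff.
have [pE qE] : p * c + q * p = delta * (2 * (p * c + q * p) + p * (a - c)) /\
               q * q = delta * 2 * (q * q).
  apply: (free2_inj ef_free); have := leib f f f; rewrite ff !mulE fe ef ff => E.
  transitivity (p *: (c *: e) + q *: (p *: e + q *: f)); first by vec_field.
  by rewrite E; vec_field.
have cE : c ^+ 2 = delta * (c ^+ 2 + q * c).
  apply: line_inj; have := leib e f f; rewrite ff !(ef, mulE) ee => E.
  transitivity (c *: (c *: e)); first by vec_field.
  by rewrite E; vec_field.
have delta2 : delta * 2 = 1.
  by apply: (mulIf q0); apply: (mulIf q0); rewrite mul1r -mulrA -qE.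
suff [t tE] : exists t, p + t * (a + c) = t * q.
  pose u := q^-1 *: (t *: e + f).
  have u0 : u != 0.
    rewrite scaler_eq0 invr_eq0 (negPf q0) -[f]scale1r.
    by rewrite (negPf (free2_comb_neq0 _ ef_free (oner_neq0 K))).
  have uu : mul u u = u.
    rewrite /u !mulE ee ef fe ff.
    transitivity (q^-1 *: (q^-1 *: ((p + t * (a + c)) *: e + q *: f))).
      by vec_field.
    by rewrite tE; vec_field.
  exact: (listed_idempotent u0 uu).
have [p0 | p0] := eqVneq p 0; first by exists 0; rewrite p0 !mul0r addr0.
have ac : a = c.
  apply/subr0_eq/(mulfI delta0)/(mulfI p0); rewrite !mulr0.
  have -> : p * (delta * (a - c)) =
      delta * (2 * (p * c + q * p) + p * (a - c)) - delta * 2 * (p * c + q * p).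
    by ring.
  by rewrite -pE delta2 mul1r subrr.
have cq : c * (c - q) = 0.
  apply: (mulfI delta0); rewrite mulr0.
  have -> : delta * (c * (c - q)) = delta * 2 * c ^+ 2 - delta * (c ^+ 2 + q * c).
    by ring.
  by rewrite -cE delta2 mul1r subrr.
have acq : q - (a + c) != 0.
  move/eqP: cq; rewrite ac mulf_eq0 subr_eq0 => /orP[] /eqP ->.
    by rewrite addr0 subr0.
  by rewrite opprD addrA subrr sub0r oppr_eq0.
by exists (p / (q - (a + c))); field.
Qed.

(** With ee = 0 the vector ef is an eigenvector of left multiplication by e, for
    the eigenvalue d. The identity at (e, e, f) and (f, e, e) gives fe = - ef
    and delta = 1; the latter makes every product x(yy) vanish, hence ff = 0. *)
Lemma listed_left_eigen d c : delta != 0 -> d != 0 ->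
  mul e f = c *: e + d *: f -> listed mul.
Proof.
move=> delta0 d0 ef.
have ef0 : mul e f != 0 by rewrite ef free2_comb_neq0.
have fe : mul f e = - mul e f.
  have := leib e e f; rewrite ee linear0l ef !mulE ee !scaler0 !add0r -scalerDr.
  move=> /esym/eqP; rewrite !scaler_eq0 (negPf delta0) (negPf d0) addr_eq0 /=.
  by move=> /eqP ->; rewrite ef.
have e_ef : mul e (mul e f) = d *: mul e f.
  by rewrite {1}ef !mulE ee scaler0 add0r.
have ef_e : mul (mul e f) e = - (d *: mul e f).
  by rewrite {1}ef !mulE ee fe scaler0 add0r scalerN.
have delta1 : delta = 1.
  apply/eqP; rewrite -subr_eq0; have := leib f e e; rewrite ee fe linear0r addr0.
  rewrite linearNl ef_e opprK => /eqP; rewrite eq_sym -subr_eq0.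
  rewrite -{2}[d *: _]scale1r -scalerBl !scaler_eq0 (negPf d0) (negPf ef0) !orbF.
  by [].
have mul_sqr0 x y : mul x (mul y y) = 0.
  have := leib x y y; rewrite delta1 scale1r -[X in X = _ -> _]addr0.
  by move=> /addrI.
have [p [q ff]] := free2_coord dimL (mul f f) ef_free.
have q0 : q = 0.
  have := mul_sqr0 e f; rewrite ff !mulE ee scaler0 add0r => /eqP.
  by rewrite scaler_eq0 (negPf ef0) orbF => /eqP.
have {}ff : mul f f = 0.
  have := mul_sqr0 f f; rewrite ff q0 scale0r addr0 mulE fe => /eqP.
  by rewrite scaler_eq0 oppr_eq0 (negPf ef0) orbF => /eqP ->; rewrite scale0r.
have f_ef : mul f (mul e f) = - (c *: mul e f).
  by rewrite {1}ef !mulE ff fe scaler0 addr0 scalerN.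
have efef : mul (mul e f) (mul e f) = 0.
  by rewrite {1}ef !mulE e_ef f_ef; vec_field.
have uv_free : free [:: d^-1 *: e; mul e f].
  apply: (free2_change (a := d^-1) (b := 0) (c := c) (d := d) ef_free) => //.
  - by vec_field.
  - by rewrite mul0r subr0 mulVf ?oner_eq0.
by do 3!right; left; apply: (alg_iso_frame dimL uv_free);
  rewrite !lincombE ?efef // ?(linearZl_LR mul) ?(linearZr_LR mul)
    ?e_ef ?ef_e ?ee ?scaler0 ?scalerN ?scalerK.
Qed.

(** Mirror of the previous case: fe is an eigenvector of right multiplication by
    e, for the eigenvalue b, and delta = 1. Here fe is annihilated on the left
    by the whole algebra, so the table of the basis (fe, e) is known without
    computing ff. *)
Lemma listed_right_eigen a b c : delta != 0 -> b != 0 ->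
  mul f e = a *: e + b *: f -> mul e f = c *: e -> listed mul.
Proof.
move=> delta0 b0 fe ef.
have fe0 : mul f e != 0 by rewrite fe free2_comb_neq0.
have fe_e : mul (mul f e) e = b *: mul f e.
  by rewrite {1}fe !mulE ee scaler0 add0r.
have delta1 : delta = 1.
  apply/eqP; rewrite -subr_eq0; have := leib f e e; rewrite ee linear0r addr0.
  rewrite fe_e => /eqP; rewrite eq_sym -subr_eq0.
  rewrite -{2}[b *: _]scale1r -scalerBl !scaler_eq0 (negPf b0) (negPf fe0) !orbF.
  by [].
have {}ef : mul e f = 0.
  have := leib e f e; rewrite ee linear0l add0r delta1 scale1r fe ef !mulE ee ef.
  rewrite !scaler0 add0r => /esym/eqP; rewrite scaler_eq0 (negPf b0) /=.
  by move/eqP.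
have e_fe : mul e (mul f e) = 0 by rewrite fe !mulE ee ef !scaler0 addr0.
have f_fe : mul f (mul f e) = 0.
  have := leib f f e; have := leib f e f; rewrite delta1 !scale1r ef linear0r addr0.
  by move=> -> /eqP; rewrite -[X in X == _]addr0 => /eqP/addrI.
have fefe : mul (mul f e) (mul f e) = 0.
  by rewrite {1}fe !mulE e_fe f_fe !scaler0 addr0.
have uv_free : free [:: mul f e; b^-1 *: e].
  apply: (free2_change (a := a) (b := b) (c := b^-1) (d := 0) ef_free) => //.
  - by vec_field.
  - by rewrite mulr0 mulfV // sub0r oppr_eq0 oner_eq0.
by do 2!right; left; apply: (alg_iso_frame dimL uv_free);
  rewrite !lincombE ?fefe // ?(linearZl_LR mul) ?(linearZr_LR mul)
    ?e_fe ?fe_e ?ee ?scaler0 ?scalerK.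
Qed.

Lemma listed_square_zero : listed mul.
Proof.
have [delta0 | delta0] := eqVneq delta 0; first exact: listed_delta0.
have [a [b fe]] := free2_coord dimL (mul f e) ef_free.
have [c [d ef]] := free2_coord dimL (mul e f) ef_free.
have [d0 | d0] := eqVneq d 0; last exact: (listed_left_eigen delta0 d0 ef).
move: ef; rewrite d0 scale0r addr0 => ef.
have [b0 | b0] := eqVneq b 0; last exact: (listed_right_eigen delta0 b0 fe ef).
move: fe; rewrite b0 scale0r addr0 => fe.
have [p [q ff]] := free2_coord dimL (mul f f) ef_free.
have [q0 | q0] := eqVneq q 0; last exact: (listed_ideal delta0 q0 fe ef ff).
move: ff; rewrite q0 scale0r addr0 => ff.
exact: (listed_ideal_nilpotent delta0 fe ef ff).
Qed.

End SquareZero.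

(** * The classification *)

Theorem leibniz_classification : listed mul.
Proof.
have [v [l [v0 vv]]] := exists_invariant_line.
have [l0 | l0] := eqVneq l 0.
  have [f vf_free] := free2_complete dimL v0.
  apply: (listed_square_zero vf_free).
  by rewrite vv l0 scale0r.
apply: (listed_idempotent (e := l^-1 *: v)).
  by rewrite scaler_eq0 invr_eq0 (negPf l0).
by rewrite (linearZl_LR mul) (linearZr_LR mul) vv scalerK.
Qed.

End Classification.

Lemma listed_leibniz (K : fieldType) : (2 : K) != 0 ->
  (forall gamma : K, leibniz_algebra gamma (A3 K)) /\
   leibniz_algebra 0 (B2_1 K) /\
   leibniz_algebra 1 (B2_0 K) /\
   leibniz_algebra 1 (B3 K) /\
   leibniz_algebra 2^-1 (D2_00 K) /\
   leibniz_algebra 2^-1 (D2_01 K) /\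
   leibniz_algebra 2^-1 (D2_11 K) /\
   leibniz_algebra 2^-1 (E1_1001 K) /\
   leibniz_algebra 2^-1 (E1_0000 K).
Proof.
move=> two0; split=> [gamma|]; [|do 7?split] => x y z; apply/rowP.
all: by case=> [[|[|//]]] lt_i; rewrite /= /table_mul !mxE /=; field.
Qed.

Theorem theorem16 (R : realType) :
  (forall (delta : R[i]) (L : vectType R[i]) (mul : {bilinear L -> L -> L}),
     \dim {:L} = 2%N ->
     leibniz_algebra delta mul ->
     (exists x y : L, mul x y != 0) ->
     alg_iso mul (A3 R[i]) \/
     alg_iso mul (B2_1 R[i]) \/
     alg_iso mul (B2_0 R[i]) \/
     alg_iso mul (B3 R[i]) \/
     alg_iso mul (D2_00 R[i]) \/
     alg_iso mul (D2_01 R[i]) \/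
     alg_iso mul (D2_11 R[i]) \/
     alg_iso mul (E1_1001 R[i]) \/
     alg_iso mul (E1_0000 R[i])) /\
  ((forall gamma : R[i], leibniz_algebra gamma (A3 R[i])) /\
   leibniz_algebra 0 (B2_1 R[i]) /\
   leibniz_algebra 1 (B2_0 R[i]) /\
   leibniz_algebra 1 (B3 R[i]) /\
   leibniz_algebra 2^-1 (D2_00 R[i]) /\
   leibniz_algebra 2^-1 (D2_01 R[i]) /\
   leibniz_algebra 2^-1 (D2_11 R[i]) /\
   leibniz_algebra 2^-1 (E1_1001 R[i]) /\
   leibniz_algebra 2^-1 (E1_0000 R[i])).
Proof.
split=> [delta L mul dimL|].
  exact: (@leibniz_classification R[i] L mul dimL delta).
by apply: listed_leibniz; rewrite Num.Theory.pnatr_eq0.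
Qed.
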